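(* Let $q$ be a power of the prime $p$. In type $A_2$ (so $W=S_3$), pick one of the $q^2$ $F$-stable elements $v$ of $\bar A_{p'}$ uniformly at random. Let $w$ be the shortest element of $W$ such that the equation $qv=wv+y$ has a solution for some $y\in Y$. The induced probability measure on $W$ agrees with that given by $x_q$; that is, for each $\sigma\in S_3$, the probability that $w=\sigma$ is the coefficient of $\sigma$ in $x_q$.
   Context: Put $n=3$. $Y=\{y\in\mathbb{Z}^n:\sum y_i=0\}$ is the coroot lattice and $W=S_n$ acts on $Y\otimes\mathbb{R}=\{v\in\mathbb{R}^n:\sum v_i=0\}$ by $w e_i=e_{w(i)}$. The affine Weyl group $\langle Y,W\rangle$ is generated by $W$ and the translations by $Y$. Its fundamental region is $\bar A=\{v\in Y\otimes\mathbb{R}: v_1\ge v_2\ge\dots\ge v_n,\ v_1-v_n\le1\}$, and each element of $Y\otimes\mathbb{R}$ is equivalent under $\langle Y,W\rangle$ to exactly one element of $\bar A$. Let $\mathbb{Q}_{p'}$ be the additive group of rational numbers $s/t$ with $s,t\in\mathbb{Z}$ and $p\nmid t$, and $\bar A_{p'}=\bar A\cap(Y\otimes\mathbb{Q}_{p'})$. $F$ acts as multiplication by $q$ on $Y\otimes\mathbb{R}$, and this induces an action on $\bar A_{p'}$ sending $v$ to the unique element of $\bar A$ equivalent to $qv$ under $\langle Y,W\rangle$; $v$ is $F$-stable if it is fixed by this action. There are $q^{n-1}$ such points. The length of $w\in S_n$ is its number of inversions; for each $F$-stable $v$ there is a unique shortest $w$ with $qv-wv\in Y$. For a positive integer $k$,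 the element $x_k$ (Cellini's element in type $A_{n-1}$) of the rational group algebra of $S_n$ is defined by: the coefficient of $w$ in $x_k$ is $\frac{1}{k^{n-1}}$ times the number of integer vectors $(v_1,\dots,v_n)$ such that (i) $v_1+\dots+v_n=0$; (ii) $v_1\ge v_2\ge\dots\ge v_n$ and $v_1-v_n\le k$; (iii) $v_i>v_{i+1}$ whenever $1\le i\le n-1$ and $w(i)>w(i+1)$; (iv) $v_1<v_n+k$ if $w(n)>w(1)$. *)

(* Defs.v *)
(* The symmetric group S_n with n = m.+1 is 'S_m.+1, so that coordinates
   1, ..., n become ord0, ..., ord_max : 'I_m.+1. *)
From HB Require Import structures.
From mathcomp Require Import all_boot all_order all_algebra fingroup perm.
From mathcomp Require Import finmap.
From mathcomp Require Import all_classical reals.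

Set Implicit Arguments.
Unset Strict Implicit.
Unset Printing Implicit Defensive.

Import Order.TTheory GRing.Theory Num.Theory.
Local Open Scope classical_set_scope.
Local Open Scope ring_scope.

Definition inversions (m : nat) (w : 'S_m.+1) : nat :=
  #|[set ij : 'I_m.+1 * 'I_m.+1 | (ij.1 < ij.2)%N && (w ij.2 < w ij.1)%N]%SET|.

(* w e_i = e_(w i), i.e. the coordinate of w v at j is the coordinate of v at w^-1 j. *)
Definition perm_act (R : realType) (m : nat) (w : 'S_m.+1) (v : 'rV[R]_m.+1) :
  'rV[R]_m.+1 := \row_j v 0 ((w^-1)%g j).

Definition coroot_lattice (R : realType) (m : nat) : set 'rV[R]_m.+1 :=
  [set y : 'rV[R]_m.+1 | (forall i, y 0 i \is a Num.int) /\ \sum_i y 0 i = 0].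

(* The group of affine maps generated by the v |-> w v and the v |-> v + y; both
   families of generators are closed under inverses, so composites suffice. *)
Inductive affine_weyl (R : realType) (m : nat) :
  ('rV[R]_m.+1 -> 'rV[R]_m.+1) -> Prop :=
| affine_weyl_id : affine_weyl (fun v => v)
| affine_weyl_perm (w : 'S_m.+1) g :
    affine_weyl g -> affine_weyl (fun v => perm_act w (g v))
| affine_weyl_trans (y : 'rV[R]_m.+1) g :
    coroot_lattice y -> affine_weyl g -> affine_weyl (fun v => g v + y).

Definition affine_equiv (R : realType) (m : nat) (u v : 'rV[R]_m.+1) : Prop :=
  exists2 g, affine_weyl g & v = g u.

Definition alcove (R : realType) (m : nat) : set 'rV[R]_m.+1 :=
  [set v : 'rV[R]_m.+1 |
    [/\ \sum_i v 0 i = 0,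
        forall i j : 'I_m.+1, (i <= j)%N -> v 0 j <= v 0 i
      & v 0 ord0 - v 0 ord_max <= 1]].

(* p %| 0 always holds, so the denominator t is nonzero. *)
Definition p'_rational (R : realType) (p : nat) : set R :=
  [set x : R | exists s t : int, ~~ (p%:Z %| t)%Z /\ x = s%:~R / t%:~R].

Definition alcove_p' (R : realType) (m p : nat) : set 'rV[R]_m.+1 :=
  [set v : 'rV[R]_m.+1 | alcove v /\ forall i, p'_rational p (v 0 i)].

(* The element of the alcove equivalent to q v; it exists and is unique whenever the
   coordinates of v sum to 0, so the default value 0 of xget is then irrelevant. *)
Definition frobenius_act (R : realType) (m q : nat) (v : 'rV[R]_m.+1) :
  'rV[R]_m.+1 :=
  xget 0 [set u : 'rV[R]_m.+1 | alcove u /\ affine_equiv (q%:R *: v) u].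

Definition F_stable (R : realType) (m p q : nat) : set 'rV[R]_m.+1 :=
  [set v : 'rV[R]_m.+1 | alcove_p' p v /\ frobenius_act q v = v].

Definition solves (R : realType) (m q : nat) (v : 'rV[R]_m.+1) (w : 'S_m.+1) : Prop :=
  exists2 y, coroot_lattice y & q%:R *: v = perm_act w v + y.

Definition is_shortest (R : realType) (m q : nat) (v : 'rV[R]_m.+1) (w : 'S_m.+1) :
  Prop :=
  solves q v w /\
  forall w', solves q v w' -> w' != w -> (inversions w < inversions w')%N.

(* The law of the shortest w when v is uniform on the (finite, nonempty) set of
   F-stable points. *)
Definition shortest_prob (R : realType) (m p q : nat) (w : 'S_m.+1) : rat :=
  (#|` fset_set [set v : 'rV[R]_m.+1 | F_stable p q v /\ is_shortest q v w]|)%:R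
  / (#|` fset_set (@F_stable R m p q)|)%:R.

Definition cellini_vectors (m k : nat) (w : 'S_m.+1) : set 'rV[int]_m.+1 :=
  [set v : 'rV[int]_m.+1 |
    [/\ \sum_i v 0 i = 0,
        (forall i j : 'I_m.+1, (i <= j)%N -> v 0 j <= v 0 i) /\
          v 0 ord0 - v 0 ord_max <= k%:Z,
        forall i j : 'I_m.+1, j = i.+1 :> nat -> (w j < w i)%N ->
          v 0 j < v 0 i
      & (w ord0 < w ord_max)%N -> v 0 ord0 < v 0 ord_max + k%:Z]].

(* An element of the rational group algebra of 'S_m.+1, given by its coefficients. *)
Definition cellini (m k : nat) : {ffun 'S_m.+1 -> rat} :=
  [ffun w : 'S_m.+1 => (#|` fset_set (cellini_vectors k w)|)%:R / (k ^ m)%:R].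

(* Main.v *)
Require Import Defs.
From mathcomp Require Import all_boot all_order all_algebra fingroup perm.
From mathcomp Require Import finmap.
From mathcomp Require Import all_classical reals.
From mathcomp Require Import zify lra.

(** Let [v] be an [F]-stable point with shortest element [w], and consider the
    lattice vector [y = q v - w v]. The theorem holds because [v |-> y] is a
    bijection from the [F]-stable points with shortest element [w] onto the
    integer vectors that Cellini counts for [w^-1]; the rest is counting.

    To see the bijection, use on the alcove the barycentric coordinates
    [a_0 = 1 - (v_1 - v_3)], [a_1 = v_1 - v_2], [a_2 = v_2 - v_3], and for [y]
    the coordinates [b_0 = q - (y_1 - y_3)], [b_1 = y_1 - y_2],
    [b_2 = y_2 - y_3]. Cellini's conditions for [w^-1] say that the integers
    [c_i = b_i - d_i] are nonnegative, where [d_i] is [1] if [w^-1] has a cyclic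
    descent at [i] and [0] otherwise. As [w^-1] permutes the roots, the equation
    [q v = w v + y] reads [q a_i = c_i + t_i], where each [t_i] is some [a_j] or
    some [1 - a_j].
    - If [v] is in the alcove, [t_i] is in [[0, 1]], so [c_i >= - 1], and the
      value [- 1] is excluded because [w] is shortest ([shortest_cellini]).
      Here the characterization of shortest solutions is used: [w] is shortest
      exactly when [v_k - v_l] is not an integer for every inversion [k < l] of
      [w] ([is_shortestP]). If such a difference is an integer, exchanging the
      values of [w] at [k] and [l] gives a shorter solution; if none is, [w] is
      increasing on each class of positions with the same coordinate modulo
      integers, and every other solution has more inversions.
    - Conversely, every integer vector [y] gives one [v], as [q - w] is
      invertible. If all [c_i] are nonnegative, they are at most [q - 1], so
      [a |-> (c + t) / q] contracts distances to the unit cube, and its fixed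
      point lies in that cube ([contraction_unit_cube], [cellini_shortest]).

    Any solution of [q v = w v + y] has coordinates with denominator prime to
    [p], and an alcove point is determined by its orbit ([alcove_equiv_eq]), so
    the [F]-stable points are the alcove points for which some [w] solves the
    equation ([F_stableP]).

    For the count, [c_0 + c_1 + c_2] is [q - 1] or [q - 2] according to the
    number of cyclic descents, and [c_1 - c_2] is prescribed modulo [3]. The six
    permutations realize the six combinations once each. The triangle
    [c_1 + c_2 <= q - 1] and the point reflection of the triangle
    [c_1 + c_2 <= q - 2] tile a square of [q ^ 2] cells, so the vectors counted
    for [x] are the cells of one of six classes ([cellini_vectors_cells]), and
    there are [q ^ 2] stable points in all ([card_F_stable]). Finally [w^-1] can
    be replaced by [w]: a [3]-cycle and its inverse have classes exchanged by the
    symmetry of the square in its diagonal ([card_cells_inv]). *)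

Set Implicit Arguments.
Unset Strict Implicit.
Unset Printing Implicit Defensive.

Import Order.TTheory GRing.Theory Num.Theory.
Local Open Scope classical_set_scope.
Local Open Scope ring_scope.

(** * The affine Weyl group and its fundamental alcove *)

Section AffineWeylGroup.
Variables (R : realType) (m : nat).
Implicit Types (u v y : 'rV[R]_m.+1) (w x : 'S_m.+1).

Lemma perm_act1 v : perm_act 1 v = v.
Proof. by apply/rowP => j; rewrite mxE invg1 perm1. Qed.

Lemma perm_actM w x v : perm_act w (perm_act x v) = perm_act (x * w)%g v.
Proof. by apply/rowP => j; rewrite !mxE invMg permM. Qed.

Lemma perm_actK w v : perm_act w^-1 (perm_act w v) = v.
Proof. by rewrite perm_actM mulgV perm_act1. Qed.

Lemma perm_actD w u v : perm_act w (u + v) = perm_act w u + perm_act w v.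
Proof. by apply/rowP => j; rewrite !mxE. Qed.

Lemma perm_actZ w (a : R) v : perm_act w (a *: v) = a *: perm_act w v.
Proof. by apply/rowP => j; rewrite !mxE. Qed.

Lemma perm_act_mulmx w v : perm_act w v = v *m perm_mx w.
Proof.
apply/rowP => j; rewrite !mxE (bigD1 (w^-1 j)%g) //= big1 => [|i neij].
  by rewrite !mxE permKV eqxx mulr1 addr0.
by rewrite !mxE -(inj_eq (@perm_inj _ w^-1%g)) permK (negPf neij) mulr0.
Qed.

Lemma sum_perm_act w v : \sum_i perm_act w v 0 i = \sum_i v 0 i.
Proof.
rewrite [RHS](reindex_inj (@perm_inj _ w^-1%g)) /=.
by apply: eq_bigr => i _; rewrite mxE.
Qed.

Lemma sum_rowD u v : \sum_i (u + v) 0 i = \sum_i u 0 i + \sum_i v 0 i.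
Proof. by rewrite -big_split /=; apply: eq_bigr => i _; rewrite mxE. Qed.

Lemma sum_rowN v : \sum_i (- v) 0 i = - \sum_i v 0 i.
Proof. by rewrite -sumrN; apply: eq_bigr => i _; rewrite mxE. Qed.

Lemma sum_rowZ (a : R) v : \sum_i (a *: v) 0 i = a * \sum_i v 0 i.
Proof. by rewrite mulr_sumr; apply: eq_bigr => i _; rewrite mxE. Qed.

Lemma coroot_lattice0 : coroot_lattice (0 : 'rV[R]_m.+1).
Proof.
by split=> [i|]; [rewrite mxE rpred0 | rewrite big1 // => i _; rewrite mxE].
Qed.

Lemma coroot_latticeD u v :
  coroot_lattice u -> coroot_lattice v -> coroot_lattice (u + v).
Proof.
move=> [Zu su] [Zv sv]; split=> [i|]; first by rewrite mxE rpredD.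
by rewrite sum_rowD su sv addr0.
Qed.

Lemma coroot_latticeN v : coroot_lattice v -> coroot_lattice (- v).
Proof.
move=> [Zv sv]; split=> [i|]; first by rewrite mxE rpredN.
by rewrite sum_rowN sv oppr0.
Qed.

Lemma coroot_latticeMn v n : coroot_lattice v -> coroot_lattice (n%:R *: v).
Proof.
move=> Yv; elim: n => [|n IHn]; first by rewrite scale0r; exact: coroot_lattice0.
by rewrite mulrSr scalerDl scale1r; exact: coroot_latticeD.
Qed.

Lemma coroot_lattice_perm w v :
  coroot_lattice v -> coroot_lattice (perm_act w v).
Proof.
by move=> [Zv sv]; split=> [i|]; [rewrite mxE | rewrite sum_perm_act].
Qed.

(** In a composite the translations can be moved past the permutations, because
    permutations preserve the coroot lattice. *)
Lemma affine_equivP u v :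
  affine_equiv u v <->
  exists w y, coroot_lattice y /\ v = perm_act w u + y.
Proof.
split=> [[g + ->{v}]|[w [y [Yy ->]]]]; last first.
  exists (fun v => perm_act w v + y) => //.
  apply: (@affine_weyl_trans _ _ _ (perm_act w)) => //.
  exact: (@affine_weyl_perm _ _ _ id (@affine_weyl_id R m)).
elim=> {g} [|x g _ [w [y [Yy ->]]]|z g Yz _ [w [y [Yy ->]]]].
- exists 1%g, 0; rewrite perm_act1 addr0; split=> //; exact: coroot_lattice0.
- exists (w * x)%g, (perm_act x y).
  by rewrite perm_actD perm_actM; split=> //; exact: coroot_lattice_perm.
- by exists w, (y + z); rewrite addrA; split=> //; exact: coroot_latticeD.
Qed.

Lemma affine_equiv_sym u v : affine_equiv u v -> affine_equiv v u.
Proof.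
move=> /affine_equivP [w [y [Yy ->]]]; apply/affine_equivP.
exists w^-1%g, (- perm_act w^-1 y); rewrite perm_actD perm_actK addrK.
by split=> //; apply/coroot_latticeN/coroot_lattice_perm.
Qed.

Lemma affine_equiv_trans u v z :
  affine_equiv u v -> affine_equiv v z -> affine_equiv u z.
Proof.
move=> /affine_equivP [w [y [Yy ->]]] /affine_equivP [x [t [Yt ->]]].
apply/affine_equivP; exists (w * x)%g, (perm_act x y + t).
rewrite perm_actD perm_actM addrA; split=> //.
by apply: coroot_latticeD => //; exact: coroot_lattice_perm.
Qed.

(** Both vectors are the sorted rearrangement of the same multiset. *)
Lemma nonincreasing_perm_eq u v w :
  (forall i j : 'I_m.+1, (i <= j)%N -> u 0 j <= u 0 i) ->
  (forall i j : 'I_m.+1, (i <= j)%N -> v 0 j <= v 0 i) ->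
  v = perm_act w u -> v = u.
Proof.
move=> su sv vwu.
have [x {vwu}vE] : exists x : 'S_m.+1, forall i, v 0 i = u 0 (x i).
  by exists w^-1%g => i; rewrite vwu mxE.
(* Reading the coordinates backwards turns nonincreasing into sorted. *)
pose s (z : 'rV[R]_m.+1) := [tuple z 0 (rev_ord i) | i < m.+1].
have sorted_s (z : 'rV[R]_m.+1) :
    (forall i j : 'I_m.+1, (i <= j)%N -> z 0 j <= z 0 i) ->
    sorted <=%O (s z).
  move=> sz; apply/(sortedP 0) => i; rewrite size_tuple => lim.
  have lim' := ltnW lim.
  rewrite -(tnth_nth 0 (s z) (Ordinal lim')) -(tnth_nth 0 (s z) (Ordinal lim)).
  by rewrite !tnth_mktuple; apply: sz => /=; lia.
suff /val_inj seq_uv : s v = s u :> seq R.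
  apply/rowP => j; have := congr1 (fun t => tnth t (rev_ord j)) seq_uv.
  by rewrite /= !tnth_mktuple rev_ordK.
apply: le_sorted_eq; rewrite ?sorted_s//.
apply/tuple_permP; exists (perm (inj_comp rev_ord_inj
  (inj_comp (@perm_inj _ x) rev_ord_inj))).
apply: eq_map => i /=.
by rewrite tnth_mktuple vE permE /= rev_ordK.
Qed.

Lemma alcove_sub_le1 v i j : alcove v -> v 0 i - v 0 j <= 1.
Proof.
move=> [_ sv]; apply: le_trans; apply: lerB; apply: sv => //=.
by rewrite -ltnS.
Qed.

Lemma sum_eq0_gt0 (T : finType) (f : T -> R) i :
  \sum_j f j = 0 -> f i != 0 -> exists j, 0 < f j.
Proof.
move=> sf fi; apply/not_existsP => Nf; move/eqP: fi; apply.
have fle j : true -> 0 <= - f j by rewrite oppr_ge0 leNgt => _; apply/negP/Nf.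
apply/eqP; rewrite -oppr_eq0; apply/eqP.
by apply: (psumr_eq0P fle) => //; rewrite sumrN sf oppr0.
Qed.

(** Let [z = w u] and suppose [v - z] is a nonzero vector of the lattice. It has
    an entry at least [1], at [i], and one at most [-1], at [j]. Coordinates of
    alcove points differ by at most [1], so both entries are extremal and
    [v_i = z_j], [v_j = z_i]. Exchanging the entries [i] and [j] of [z] therefore
    increases the number of positions where [z] and [v] agree. *)
Lemma alcove_equiv_perm u v w :
  alcove u -> alcove v -> coroot_lattice (v - perm_act w u) ->
  exists x, v = perm_act x u.
Proof.
move=> Au Av.
have [k] := ubnP #|[set i | v 0 i != perm_act w u 0 i]%SET|.
elim: k w => // k IHk w; set z := perm_act w u => lek [Zy sy].
case: (pickP [pred i | v 0 i != z 0 i]) => [i0 /= vzi0|eqvz]; last first.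
  by exists w; apply/rowP => i; apply/eqP; move/negbFE: (eqvz i).
pose y i := v 0 i - z 0 i.
have Zy' i : y i \is a Num.int by have := Zy i; rewrite /y /z !mxE.
have sy' : \sum_i y i = 0.
  by rewrite -[RHS]sy; apply: eq_bigr => i _; rewrite /y /z !mxE.
have yi0 : y i0 != 0 by rewrite subr_eq0.
have [i yi] : exists i, 0 < y i by apply: sum_eq0_gt0 sy' yi0.
have [j yj] : exists j, 0 < - y j.
  apply: (@sum_eq0_gt0 _ (fun j => - y j) i0); last by rewrite oppr_eq0.
  by rewrite sumrN sy' oppr0.
have {}yi : 1 <= y i by case/intrP: (Zy' i) yi => n ->; rewrite ltr0z ler1z.
have {}yj : 1 <= - y j.
  by case/intrP: (Zy' j) yj => n ->; rewrite -mulrNz ltr0z ler1z.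
have vij := alcove_sub_le1 i j Av.
have zij : z 0 j - z 0 i <= 1 by rewrite !mxE; exact: alcove_sub_le1.
have zj : v 0 j = z 0 i by rewrite /y in yi yj; lra.
have zi : v 0 i = z 0 j by rewrite /y in yi yj; lra.
have nij : i != j by apply: contraTN yj => /eqP <-; rewrite -ltNge; lra.
pose x := (w * tperm i j)%g.
have zxE l : perm_act x u 0 l = z 0 (tperm i j l).
  by rewrite -perm_actM mxE tpermV.
apply: (IHk x).
  rewrite -ltnS; apply: leq_trans lek; rewrite ltnS; apply: proper_card.
  apply/properP; split; last first.
    exists i; rewrite inE ?zxE ?tpermL ?zi ?eqxx //.
    by rewrite -subr_eq0 -zi; apply: contraTneq yi => yi; rewrite /y yi ler10.
  apply/fintype.subsetP => l; rewrite !inE zxE.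
  by case: tpermP => [->|->|//]; rewrite ?zi ?zj eqxx.
split=> [l|].
  rewrite !mxE -/(y l); have := zxE l; rewrite mxE => ->.
  by case: tpermP => [->|->|_ _]; rewrite ?zi ?zj ?subrr ?rpred0 //; apply: Zy'.
by move: sy; rewrite !sum_rowD !sum_rowN !sum_perm_act.
Qed.

Lemma alcove_equiv_eq u v : alcove u -> alcove v -> affine_equiv u v -> v = u.
Proof.
move=> Au Av /affine_equivP [w [y [Yy vE]]].
have [|x xE] := @alcove_equiv_perm u v w Au Av.
  by rewrite vE addrAC subrr add0r.
by apply: nonincreasing_perm_eq xE; [case: Au | case: Av].
Qed.

End AffineWeylGroup.

(** * Stable points and their solutions *)

Section FStable.
Variables (R : realType) (m : nat).
Implicit Types (u v y : 'rV[R]_m.+1) (w x : 'S_m.+1).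

(** The coordinates of [q v - w v] sum to [0] as soon as those of [v] do, so only
    integrality is left, and reading it at [w i] avoids [w^-1]. *)
Lemma solvesP q v w : \sum_i v 0 i = 0 ->
  solves q v w <-> forall i, q%:R * v 0 (w i) - v 0 i \is a Num.int.
Proof.
move=> sv; split=> [[y [Zy _] vE] i|Zv].
  have := congr1 (fun z : 'rV[R]_m.+1 => z 0 (w i)) vE.
  by rewrite !mxE permK => ->; rewrite addrAC subrr add0r.
exists (q%:R *: v - perm_act w v); last by rewrite addrC subrK.
split=> [i|]; first by have := Zv (w^-1%g i); rewrite permKV !mxE.
by rewrite sum_rowD sum_rowN sum_rowZ sum_perm_act sv mulr0 subr0.
Qed.

(** This is [tperm k l * w] because products of permutations are read from left to
    right: the values of [w] at [k] and [l] are exchanged. *)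
Lemma solves_tperm q v w k l : \sum_i v 0 i = 0 ->
  solves q v w -> v 0 k - v 0 l \is a Num.int ->
  solves q v (tperm k l * w)%g.
Proof.
move=> sv; rewrite !solvesP // => Zw Zkl i; rewrite permM.
case: tpermP => [->|->|_ _]; last exact: Zw.
  by rewrite -(subrKA (v 0 l)) rpredD // -opprB rpredN.
by rewrite -(subrKA (v 0 k)) rpredD.
Qed.

Lemma solvesX q v w k : solves q v w -> solves (q ^ k) v (w ^+ k)%g.
Proof.
move=> [y Yy vE]; elim: k => [|k [z Yz IHk]].
  exists 0; first exact: coroot_lattice0.
  by rewrite perm_act1 scale1r addr0.
exists (perm_act (w ^+ k)%g y + q%:R *: z).
  by apply: coroot_latticeD;
    [exact: coroot_lattice_perm | exact: coroot_latticeMn].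
rewrite expnS natrM -scalerA IHk scalerDr -perm_actZ vE perm_actD perm_actM.
by rewrite -expgS addrA.
Qed.

Lemma affine_equiv_solves q v :
  affine_equiv (q%:R *: v) v <-> exists w, solves q v w.
Proof.
split=> [/affine_equiv_sym/affine_equivP [w [y [Yy vE]]]|[w [y Yy vE]]].
  by exists w, y.
by apply/affine_equiv_sym/affine_equivP; exists w, y.
Qed.

(** Iterating [q v = w v + y] as many times as the order of [w] shows that
    [(q ^ k - 1) v] is integral for some [k > 0], and [p] does not divide
    [q ^ k - 1]. *)
Lemma solves_p'_rational p e v w i : prime p -> (0 < e)%N ->
  solves (p ^ e) v w -> p'_rational p (v 0 i).
Proof.
move=> p_pr e_gt0 /(@solvesX _ _ _ #[w]%g); rewrite expg_order.
move=> [y [/(_ i)/intrP [s yE] _]] /(congr1 (fun z : 'rV[R]_m.+1 => z 0 i)).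
rewrite perm_act1 !mxE yE -expnM.
set n := (p ^ _)%N => vE; exists s, (n%:Z - 1).
have pn : (p %| n)%N by rewrite dvdn_exp // muln_gt0 e_gt0 order_gt0.
have n1 : (1 < n)%N.
  by rewrite -(expn0 p) ltn_exp2l ?prime_gt1 // muln_gt0 e_gt0 order_gt0.
split.
  apply/negP => pn1; have : 1 \in dvdz p%:Z.
    by rewrite -(subKr n%:Z 1) rpredB.
  by rewrite dvdzE /= dvdn1; have := prime_gt1 p_pr; lia.
have n1R : (n%:Z - 1)%:~R != 0 :> R by rewrite intr_eq0; lia.
apply: (mulIf n1R); rewrite divfK // rmorphB /= mulrBr mulr1.
by rewrite -pmulrn mulrC vE addrAC subrr add0r.
Qed.

Lemma F_stableP p e v : prime p -> (0 < e)%N ->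
  F_stable p (p ^ e) v <-> alcove v /\ exists w, solves (p ^ e) v w.
Proof.
move=> p_pr e_gt0; split=> [[[Av _] Fv]|[Av [w vw]]].
  split=> //; apply/affine_equiv_solves.
  move: Fv; rewrite /frobenius_act.
  (* In the default case [v = 0], which is equivalent to [q v = 0]. *)
  case: xgetP => [u _ [_ uE] uv|_ v0]; first by rewrite -[X in affine_equiv _ X]uv.
  rewrite -v0 scaler0.
  apply/affine_equivP; exists 1%g, 0.
  by rewrite perm_act1 addr0; split=> //; exact: coroot_lattice0.
split; first by split=> // i; exact: solves_p'_rational vw.
have vE : affine_equiv ((p ^ e)%:R *: v) v by apply/affine_equiv_solves; exists w.
apply: xget_unique => // u [Au uE]; apply: alcove_equiv_eq => //.
by apply: affine_equiv_trans uE; exact: affine_equiv_sym.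
Qed.

End FStable.

(** * Permutations of three letters *)

Notation o0 := (@ord0 2).
Notation o1 := (lift (@ord0 2) (@ord0 1)).
Notation o2 := (@ord_max 2).

Lemma sum3E (V : nmodType) (F : 'I_3 -> V) : \sum_i F i = F o0 + F o1 + F o2.
Proof.
rewrite !big_ord_recl big_ord0 addr0 addrA; congr (_ + F _).
exact: val_inj.
Qed.

Lemma ord3P (i : 'I_3) : [\/ i = o0, i = o1 | i = o2].
Proof.
by case: i => [[|[|[|//]]] lti]; [apply: Or31 | apply: Or32 | apply: Or33];
  apply: val_inj.
Qed.

(** The values of [w] followed by those of its inverse. Tabulating both makes each
    of the six cases of [S3_cases] a plain rewriting. *)
Definition S3_line (w : 'S_3) a b c x y z :=
  [/\ w o0 = a, w o1 = b & w o2 = c] /\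
  [/\ w^-1%g o0 = x, w^-1%g o1 = y & w^-1%g o2 = z].

Lemma S3_cases (w : 'S_3) :
  [\/ S3_line w o0 o1 o2 o0 o1 o2,
      S3_line w o1 o0 o2 o1 o0 o2,
      S3_line w o0 o2 o1 o0 o2 o1 |
    [\/ S3_line w o2 o1 o0 o2 o1 o0,
        S3_line w o1 o2 o0 o2 o0 o1 |
        S3_line w o2 o0 o1 o1 o2 o0]].
Proof.
have inj i j : i != j -> w i <> w j by move=> nij /perm_inj/eqP; apply/negP.
have [[n01 n02] n12] := (inj o0 o1 isT, inj o0 o2 isT, inj o1 o2 isT).
have inv i j : w i = j -> w^-1%g j = i by move=> <-; rewrite permK.
case: (ord3P (w o0)) => w0; case: (ord3P (w o1)) => w1;
  case: (ord3P (w o2)) => w2;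
  move: n01 n02 n12; rewrite ?w0 ?w1 ?w2 // => _ _ _.
all: have := (inv _ _ w0, inv _ _ w1, inv _ _ w2); move=> [[v0 v1] v2].
- by apply: Or41.
- by apply: Or43.
- by apply: Or42.
- by apply: Or44; apply: Or32.
- by apply: Or44; apply: Or33.
- by apply: Or44; apply: Or31.
Qed.

Lemma inversions3E (w : 'S_3) :
  inversions w = ((w o1 < w o0) + (w o2 < w o0) + (w o2 < w o1))%N.
Proof.
rewrite /inversions -sum1_card big_mkcond /=.
pose f (i j : 'I_3) : nat := (i < j)%N && (w j < w i)%N.
rewrite (eq_bigr (fun p => f p.1 p.2)) => [|p _]; last first.
  by rewrite inE /f; case: ifP.
rewrite -(pair_bigA _ f) /= !sum3E /f /=.
by rewrite !add0r !addr0.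
Qed.

Lemma inversions_tperm (w : 'S_3) (k l : 'I_3) : (k < l)%N -> (w l < w k)%N ->
  (inversions (tperm k l * w)%g < inversions w)%N.
Proof.
rewrite !inversions3E !permM.
by case: (ord3P k) => ->; case: (ord3P l) => -> // _;
  rewrite ?tpermL ?tpermR ?[tperm _ _ o0]tpermD ?[tperm _ _ o1]tpermD
    ?[tperm _ _ o2]tpermD //; lia.
Qed.

(** * Shortest solutions in rank two *)

Lemma shortest_unique (R : realType) (m q : nat) (v : 'rV[R]_m.+1) w x :
  is_shortest q v w -> is_shortest q v x -> w = x.
Proof.
move=> [vw wmin] [vx xmin]; apply/eqP; apply: contraT => neq.
have := wmin x vx; rewrite eq_sym neq => /(_ isT) lt1.
by have := ltn_trans lt1 (xmin w vw neq); rewrite ltnn.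
Qed.

Section Shortest.
Variables (R : realType) (q : nat) (v : 'rV[R]_3).
Hypothesis sv : \sum_i v 0 i = 0.

(** If [v_k - v_l] is an integer for an inversion [k < l], exchanging two values of
    [w] gives a shorter solution. Conversely, two solutions [w] and [x] differ by
    a permutation of the positions that preserves the classes of coordinates
    modulo integers; if [w] is increasing on each class, every other [x] has more
    inversions. The latter is verified on the 36 pairs of permutations. *)
Lemma is_shortestP (w : 'S_3) : is_shortest q v w <-> solves q v w /\
  (forall k l : 'I_3, (k < l)%N -> (w l < w k)%N ->
     v 0 k - v 0 l \isn't a Num.int).
Proof.
split=> [[qvw wmin]|[qvw Nint]]; split=> //; last move=> x qvx neqxw.
  move=> k l ltkl wlk.
  apply/negP => Zkl.
  have /(wmin _ (solves_tperm sv qvw Zkl))/ltnW : (tperm k l * w)%g != w.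
    by apply: contraTneq (inversions_tperm ltkl wlk) => ->; rewrite ltnn.
  by rewrite leqNgt inversions_tperm.
pose e i j := v 0 i - v 0 j \is a Num.int.
have e_refl i : e i i by rewrite /e subrr rpred0.
have e_sym i j : e i j = e j i by rewrite /e -opprB rpredN.
have e_trans j i k : e i j -> e j k -> e i k.
  by rewrite /e -{2}[v 0 i](subrK (v 0 j)) -addrA; apply: rpredD.
have e_wx i : e (w^-1%g i) (x^-1%g i).
  move: qvw qvx; rewrite !solvesP // => /(_ (w^-1%g i)) Zw /(_ (x^-1%g i)) Zx.
  rewrite !permKV in Zw Zx.
  by rewrite /e -(subrKA (q%:R * v 0 i)) addrC rpredD // -opprB rpredN.
have [T1 T2 T3] :=
  And3 (@e_trans o1 o0 o2) (@e_trans o2 o0 o1) (@e_trans o0 o1 o2).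
have [N1 N2 N3] := And3 (Nint o0 o1 isT) (Nint o0 o2 isT) (Nint o1 o2 isT).
have [E1 E2 E3] := And3 (e_wx o0) (e_wx o1) (e_wx o2).
rewrite -!/(e _ _) in N1 N2 N3.
rewrite !inversions3E.
have eqxw : x o0 = w o0 -> x o1 = w o1 -> x o2 = w o2 -> False.
  move=> x0 x1 x2; move/negP: neqxw; apply; apply/eqP/permP => i.
  by case: (ord3P i) => ->.
rewrite ?(e_sym o1 o0) ?(e_sym o2 o0) ?(e_sym o2 o1) in T1 T2 T3.
case: (S3_cases w) => [|||[]] [[w0 w1 w2] [w0' w1' w2']];
case: (S3_cases x) => [|||[]] [[x0 x1 x2] [x0' x1' x2']].
all: rewrite ?w0 ?w1 ?w2 ?x0 ?x1 ?x2 // in eqxw N1 N2 N3 *; try by case: eqxw.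
all: rewrite ?w0' ?w1' ?w2' ?x0' ?x1' ?x2' ?(e_sym o1 o0) ?(e_sym o2 o0)
  ?(e_sym o2 o1) ?e_refl in E1 E2 E3.
all: try by move: (N1) (N2) (N3) => /=; rewrite ?E1 ?E2 ?E3; auto.
all: move: T1 T2 T3 N1 N2 N3 E1 E2 E3.
all: by case: (e o0 o1) (e o0 o2) (e o1 o2) => [] [] [] /=; auto.
Qed.

Lemma exists_shortest (w : 'S_3) :
  solves q v w -> exists x, is_shortest q v x.
Proof.
move=> qvw; have [x /asboolP qvx xmin] :=
  @arg_minnP _ w (fun x => `[< solves q v x >]) (@inversions 2)
    (introT (asboolP _) qvw).
exists x; apply/is_shortestP; split=> // k l ltkl wlk; apply/negP => Zkl.
have /asboolP/xmin := solves_tperm sv qvx Zkl.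
by rewrite leqNgt inversions_tperm.
Qed.

End Shortest.

(** * Translation vectors of stable points are Cellini vectors *)

(** Centre the cube at [0]: for an index [i] maximizing [`|a i - 1/2|] the equation
    gives [q * `|a i - 1/2| <= (q - 1)/2 + `|a i - 1/2|], whence
    [`|a i - 1/2| <= 1/2]. *)
Lemma contraction_unit_cube (R : realFieldType) (T : finType) (q : R)
    (a c t : T -> R) : 1 < q ->
  (forall i, q * a i = c i + t i) -> (forall i, 0 <= c i <= q - 1) ->
  (forall i, exists j, t i = a j \/ t i = 1 - a j) ->
  forall i, 0 <= a i <= 1.
Proof.
move=> q1 aE c01 tE i0.
pose b i := `|a i - 1 / 2|.
case: (@Order.TotalTheory.arg_maxP _ _ _ i0 predT b) => // i _ bmax.
have bt : `|t i - 1 / 2| <= b i.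
  have [j [->|->]] := tE i; first exact: bmax.
  have -> : 1 - a j - 1 / 2 = - (a j - 1 / 2) by lra.
  by rewrite normrN; exact: bmax.
have {}bi : b i <= 1 / 2.
  have : q * b i <= (q - 1) / 2 + b i.
    rewrite -[q in q * _]gtr0_norm ?(lt_trans ltr01) // -normrM.
    have -> : q * (a i - 1 / 2) = (c i - (q - 1) / 2) + (t i - 1 / 2).
      by rewrite mulrBr aE; lra.
    apply: le_trans (ler_normD _ _) _; apply: lerD => //.
    by rewrite ler_norml; have := c01 i; lra.
  rewrite -lerBlDr => H; have : (q - 1) * b i <= (q - 1) * (1 / 2) by lra.
  by rewrite ler_pM2l // subr_gt0.
have : b i0 <= 1 / 2 by apply: le_trans bi; exact: bmax.
by rewrite ler_norml; lra.
Qed.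

Lemma alcove3P (R : realType) (v : 'rV[R]_3) : alcove v <->
  [/\ \sum_i v 0 i = 0, v 0 o1 <= v 0 o0, v 0 o2 <= v 0 o1
    & v 0 o0 - v 0 o2 <= 1].
Proof.
split=> [[sv vle v1]|[sv v01 v12 v1]]; first by split=> //; apply: vle.
split=> // i j; case: (ord3P i) => ->; case: (ord3P j) => -> // _; lra.
Qed.

(** The three inequalities are the conditions of nonnegativity of the [c_i]: strict
    inequalities between integers are absorbed into the cyclic descents. *)
Lemma cellini3P q (w : 'S_3) (u : 'rV[int]_3) : cellini_vectors q w u <->
  [/\ \sum_i u 0 i = 0,
      u 0 o1 + (w o1 < w o0)%N%:Z <= u 0 o0,
      u 0 o2 + (w o2 < w o1)%N%:Z <= u 0 o1
    & u 0 o0 + (w o0 < w o2)%N%:Z <= u 0 o2 + q%:Z].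
Proof.
split=> [[su [ule uq] udes uasc]|[su u01 u12 uq]].
  have [u01 u12] := (ule o0 o1 isT, ule o1 o2 isT).
  have [d01 d12] := (udes o0 o1 erefl, udes o1 o2 erefl).
  split=> //.
  - by case: ltnP d01 => [_ /(_ isT)|_ _] /=; lia.
  - by case: ltnP d12 => [_ /(_ isT)|_ _] /=; lia.
  - by case: ltnP uasc => [_ /(_ isT)|_ _] /=; lia.
split=> //.
- split=> [i j|]; last by lia.
  by case: (ord3P i) => ->; case: (ord3P j) => -> // _; lia.
- move=> i j; case: (ord3P i) => ->; case: (ord3P j) => -> //= _ ltw;
    rewrite ?ltw in u01 u12 *; lia.
- by move=> ltw; rewrite ltw in uq; lia.
Qed.

Lemma lt_intrD1 (R : realType) (a b : int) (d : nat) :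
  a%:~R + d%:R - 1 < b%:~R :> R -> a + d%:Z <= b.
Proof.
by rewrite [d%:R]pmulrn -[1]/(1%:~R) -intrD -intrB ltr_int -ltzD1 ltrBlDr.
Qed.

Lemma intr_Nlt01 (R : realType) (x : R) : 0 < x < 1 -> x \isn't a Num.int.
Proof.
move=> /andP[gt0 lt1]; apply/negP => /intrP [n nE]; move: gt0 lt1.
by rewrite nE ltr0z -[1]/(1%:~R) ltr_int; lia.
Qed.

Section TranslationVector.
Variables (R : realType) (q : nat) (v : 'rV[R]_3) (u : 'rV[int]_3) (w : 'S_3).
Hypotheses (q1 : (1 < q)%N) (sv : \sum_i v 0 i = 0).
Hypothesis vE : q%:R *: v = perm_act w v + map_mx intr u.

Let q2 : (2 : R) <= q%:R. Proof. by rewrite ler_nat. Qed.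

Let sum_u : \sum_i map_mx intr u 0 i = 0 :> R.
Proof.
have -> : map_mx intr u = q%:R *: v - perm_act w v.
  by rewrite vE addrAC subrr add0r.
by rewrite sum_rowD sum_rowN sum_rowZ sum_perm_act sv mulr0 subr0.
Qed.

Let solves_w : solves q v w.
Proof. by exists (map_mx intr u) => //; split=> // i; rewrite mxE intr_int. Qed.

Let coord j : q%:R * v 0 j = v 0 (w^-1%g j) + (u 0 j)%:~R.
Proof. by have := congr1 (fun z : 'rV[R]_3 => z 0 j) vE; rewrite !mxE. Qed.

(** Writing [q a_i = c_i + t_i] with [t_i] in [[0, 1]], the case [c_i = - 1] would
    need [a_i = 0] and [t_i = 1]. This is absurd at once if [t_i] is [a_i], and
    otherwise contradicts the strict inequalities that the inversions of [w]
    impose on [v]. *)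
Lemma shortest_cellini :
  alcove v -> is_shortest q v w -> cellini_vectors q w^-1 u.
Proof.
move=> /alcove3P [_ v01 v12 v02] /is_shortestP-/(_ sv) [_ Nint].
have [E0 E1 E2] := And3 (coord o0) (coord o1) (coord o2).
have svE := sv; rewrite sum3E in svE.
(* The products of [q] with coordinates are atoms for linear arithmetic, so the
   consequence [2 * a_i <= q * a_i] of [2 <= q] is supplied for each [a_i]. *)
have mul2 (x : R) : 0 <= x -> 2 * x <= q%:R * x by move=> x0; exact: ler_wpM2r.
have [P0 P1 P2] : [/\
    2 * (1 - (v 0 o0 - v 0 o2)) <= q%:R * (1 - (v 0 o0 - v 0 o2)),
    2 * (v 0 o0 - v 0 o1) <= q%:R * (v 0 o0 - v 0 o1)
  & 2 * (v 0 o1 - v 0 o2) <= q%:R * (v 0 o1 - v 0 o2)].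
  by split; apply: mul2; rewrite subr_ge0.
have {}Nint (k l : 'I_3) : 0 <= v 0 k - v 0 l <= 1 ->
    (k < l)%N -> (w l < w k)%N -> 0 < v 0 k - v 0 l < 1.
  move=> /andP[ge0 le1] kl /(Nint k l kl) nint.
  rewrite !lt_neqAle ge0 le1 !andbT; apply/andP; split.
    by apply: contraNneq nint => <-; rewrite rpred0.
  by apply: contraNneq nint => ->; rewrite rpred1.
have N01 : (w o1 < w o0)%N -> 0 < v 0 o0 - v 0 o1 < 1 by apply: Nint => //; lra.
have N02 : (w o2 < w o0)%N -> 0 < v 0 o0 - v 0 o2 < 1 by apply: Nint => //; lra.
have N12 : (w o2 < w o1)%N -> 0 < v 0 o1 - v 0 o2 < 1 by apply: Nint => //; lra.
(* For the integers [c_i], [- 1 < c_i] means [0 <= c_i]. *)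
suff [C1 C2 C0] : [/\
    (u 0 o1)%:~R + (w^-1%g o1 < w^-1%g o0)%N%:R - 1 < (u 0 o0)%:~R :> R,
    (u 0 o2)%:~R + (w^-1%g o2 < w^-1%g o1)%N%:R - 1 < (u 0 o1)%:~R :> R
  & (u 0 o0)%:~R + (w^-1%g o0 < w^-1%g o2)%N%:R - 1 < (u 0 o2)%:~R + q%:R :> R].
  apply/cellini3P; split; try by apply: (@lt_intrD1 R); rewrite ?rmorphD.
  apply: (@intr_inj R); rewrite rmorph_sum -[RHS]sum_u.
  by apply: eq_bigr => i _; rewrite mxE.
move: P0 P1 P2 v01 v12 v02 svE E0 E1 E2 N01 N02 N12; clear.
case: (S3_cases w) => [|||[]] [[-> -> ->] [-> -> ->]] /=.
all: move: (v 0 o0) (v 0 o1) (v 0 o2) (q%:R : R) => v0 v1 v2 Q.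
all: move: ((u 0 o0)%:~R : R) ((u 0 o1)%:~R : R) ((u 0 o2)%:~R : R) => u0 u1 u2.
all: move=> P0 P1 P2 v01 v12 v02 svE E0 E1 E2.
- by move=> _ _ _; split; lra.
- by move=> /(_ isT) N01 _ _; split; lra.
- by move=> _ _ /(_ isT) N12; split; lra.
- by move=> /(_ isT) N01 /(_ isT) N02 /(_ isT) N12; split; lra.
- by move=> _ /(_ isT) N02 /(_ isT) N12; split; lra.
- by move=> /(_ isT) N01 /(_ isT) N02 _; split; lra.
Qed.

(** The fixed point [a] of a contraction towards the unit cube lies in it, which
    places [v] in the alcove. If an inversion of [w] had an integral difference of
    coordinates, some [a_i] would vanish; [q a_i = c_i + t_i] with [c_i >= 0] and
    [t_i >= 0] then forces [c_i = t_i = 0], and the other equations contradict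
    the value [1] of the sum of the [a_i] or the bounds on the [c_i]. *)
Lemma cellini_shortest :
  cellini_vectors q w^-1 u -> alcove v /\ is_shortest q v w.
Proof.
move=> /cellini3P[_ C1 C2 C0].
have {}C1 : (u 0 o1)%:~R + (w^-1%g o1 < w^-1%g o0)%N%:R <= (u 0 o0)%:~R :> R.
  by rewrite pmulrn -intrD ler_int.
have {}C2 : (u 0 o2)%:~R + (w^-1%g o2 < w^-1%g o1)%N%:R <= (u 0 o1)%:~R :> R.
  by rewrite pmulrn -intrD ler_int.
have {}C0 : (u 0 o0)%:~R + (w^-1%g o0 < w^-1%g o2)%N%:R
    <= (u 0 o2)%:~R + q%:R :> R.
  by rewrite !pmulrn -!intrD ler_int.
have [E0 E1 E2] := And3 (coord o0) (coord o1) (coord o2).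
have svE := sv; rewrite sum3E in svE.
have suE := sum_u; rewrite sum3E !mxE in suE.
pose a (i : 'I_3) :=
  [:: 1 - (v 0 o0 - v 0 o2); v 0 o0 - v 0 o1; v 0 o1 - v 0 o2]`_i.
pose c (i : 'I_3) :=
  [:: (u 0 o2)%:~R + q%:R - (u 0 o0)%:~R - (w^-1%g o0 < w^-1%g o2)%N%:R;
      (u 0 o0)%:~R - (u 0 o1)%:~R - (w^-1%g o1 < w^-1%g o0)%N%:R;
      (u 0 o1)%:~R - (u 0 o2)%:~R - (w^-1%g o2 < w^-1%g o1)%N%:R : R]`_i.
have a01 : forall i, 0 <= a i <= 1.
  apply: (contraction_unit_cube (q := q%:R) (c := c)
    (t := fun i => q%:R * a i - c i)).
  - by rewrite ltr1n.
  - by move=> i; rewrite addrC subrK.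
  - move=> i; rewrite /c; move: C0 C1 C2 suE; clear.
    case: (S3_cases w) => [|||[]] [_ [-> -> ->]] /=; case: (ord3P i) => -> /=;
      by move: ((u 0 o0)%:~R : R) ((u 0 o1)%:~R : R) ((u 0 o2)%:~R : R) (q%:R : R)
        => u0 u1 u2 Q C0 C1 C2 suE; lra.
  - move=> i; rewrite /c /a; move: E0 E1 E2 svE; clear.
    case: (S3_cases w) => [|||[]] [_ [-> -> ->]] /=; case: (ord3P i) => -> /=;
    move: (v 0 o0) (v 0 o1) (v 0 o2) (q%:R : R) => v0 v1 v2 Q;
    move: ((u 0 o0)%:~R : R) ((u 0 o1)%:~R : R) ((u 0 o2)%:~R : R)
      => u0 u1 u2 E0 E1 E2 svE;
    first [ by exists o0; left => /=; lra | by exists o0; right => /=; lra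
          | by exists o1; left => /=; lra | by exists o1; right => /=; lra
          | by exists o2; left => /=; lra | by exists o2; right => /=; lra ].
have [] := And3 (a01 o0) (a01 o1) (a01 o2); rewrite /a /= => A0 A1 A2.
split; first by apply/alcove3P; split=> //; lra.
apply/is_shortestP => //; split=> // k l kl wlk; apply: intr_Nlt01.
(* Linear arithmetic does not see that [q * x = 0] when [x = 0]. *)
have pos (x : R) : 0 <= x <= 1 -> 0 < x \/ x = 0 /\ q%:R * x = 0.
  move=> /andP[]; rewrite le_eqVlt => /predU1P[<- _|]; last by left.
  by right; rewrite mulr0.
suff [N01 N02 N12] : [/\ (w o1 < w o0)%N -> 0 < v 0 o0 - v 0 o1 < 1,
    (w o2 < w o0)%N -> 0 < v 0 o0 - v 0 o2 < 1
  & (w o2 < w o1)%N -> 0 < v 0 o1 - v 0 o2 < 1].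
  by move: kl wlk; case: (ord3P k) => ->; case: (ord3P l) => -> //.
have [Z0 Z1 Z2] := And3 (pos _ A0) (pos _ A1) (pos _ A2).
move: Z0 Z1 Z2 C0 C1 C2 E0 E1 E2 suE svE A0 A1 A2; clear.
case: (S3_cases w) => [|||[]] [[-> -> ->] [-> -> ->]] /=.
all: move: (v 0 o0) (v 0 o1) (v 0 o2) (q%:R : R) => v0 v1 v2 Q.
all: move: ((u 0 o0)%:~R : R) ((u 0 o1)%:~R : R) ((u 0 o2)%:~R : R) => u0 u1 u2.
all: move=> Z0 Z1 Z2 C0 C1 C2 E0 E1 E2 suE svE A0 A1 A2; split=> // _.
all: by case: Z0 => [?|[? ?]]; case: Z1 => [?|[? ?]];
  case: Z2 => [?|[? ?]]; lra.
Qed.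

End TranslationVector.

(** * Counting Cellini vectors by cells of a square *)

Lemma card_fset_set_image (T : finType) (U : choiceType) (f : T -> U)
    (P : {pred T}) :
  {in P &, injective f} -> #|` fset_set (f @` [set x | x \in P]) | = #|P|.
Proof.
move=> injf; set A := seq_fset tt [seq f x | x in P].
have -> : f @` [set x | x \in P] = [set` A].
  apply/seteqP; split=> y /=; rewrite seq_fsetE.
    by move=> [x Px <-]; exact: fintype.image_f.
  by move=> /fintype.imageP[x Px ->]; exists x.
by rewrite set_fsetK size_seq_fset undup_id ?size_image //; apply/dinjectiveP.
Qed.

Section Cells.
Variable q : nat.
Implicit Types (x : 'S_3) (c : 'I_q * 'I_q).

(** The index [0] stands for the wrap-around pair: position [2] followed by [0]. *)
Definition cyc_descent x (i : nat) : nat :=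
  nth false [:: (x o0 < x o2)%N; (x o1 < x o0)%N; (x o2 < x o1)%N] i.

(** A permutation of three letters has one or two cyclic descents. *)
Definition one_cyc_descent x :=
  (cyc_descent x 0 + cyc_descent x 1 + cyc_descent x 2 == 1)%N.

(** Let [b_i = c_i + d_i], where [d_i] are the cyclic descents. An integer vector
    with successive differences [b_1], [b_2] and sum [0] exists exactly when
    [b_1 - b_2 = 0] modulo [3]; this prescribes the residue of
    [c_1 - c_2 = c_1 + 2 c_2] modulo [3]. With one cyclic descent the cell of the
    vector is [(c_1, c_2)]; with two it is [(q - 1 - c_1, q - 1 - c_2)], which
    changes the sign of that residue. *)
Definition perm_class x : bool * 'I_3 := (one_cyc_descent x,
  inord ((if one_cyc_descent x
          then cyc_descent x 1 + cyc_descent x 1 + cyc_descent x 2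
          else cyc_descent x 1 + cyc_descent x 2 + cyc_descent x 2) %% 3)).

Definition cell_class c : bool * 'I_3 :=
  ((c.1 + c.2 < q)%N, inord ((c.1 + c.2 + c.2) %% 3)).

Lemma perm_class_inj : injective perm_class.
Proof.
move=> x y; rewrite /perm_class /one_cyc_descent /cyc_descent.
case: (S3_cases x) => [|||[]] [[x0 x1 x2] _];
  case: (S3_cases y) => [|||[]] [[y0 y1 y2] _].
all: rewrite /= ?x0 ?x1 ?x2 ?y0 ?y1 ?y2 //=.
all: try by move=> /(congr1 (fun p => val p.2)); rewrite /= !inordK.
all: move=> _; apply/permP => i.
all: by case: (ord3P i) => ->; rewrite ?x0 ?x1 ?x2 ?y0 ?y1 ?y2.
Qed.

Lemma perm_class_bij : bijective perm_class.
Proof.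
apply: inj_card_bij perm_class_inj _.
by rewrite card_prod card_bool card_ord card_Sn.
Qed.

(** The vector with successive differences [b_1], [b_2] and sum [0]; [k] is its
    middle coordinate up to sign, an exact quotient for the cells of the class of
    [x]. *)
Definition cell_vector x c : 'rV[int]_3 :=
  let b1 := (if one_cyc_descent x then c.1 : nat else (q.-1 - c.1)%N)
    + cyc_descent x 1 in
  let b2 := (if one_cyc_descent x then c.2 : nat else (q.-1 - c.2)%N)
    + cyc_descent x 2 in
  let k := ((b1%:Z - b2%:Z) %/ 3)%Z in
  \row_(j < 3) [:: b1%:Z - k; - k; - k - b2%:Z]`_j.

Lemma cell_vector_inj x : injective (cell_vector x).
Proof.
move=> [c1 c2] [d1 d2] /rowP E; have := E o0; have := E o1; have := E o2.
rewrite !mxE /=; move: (ltn_ord c1) (ltn_ord c2) (ltn_ord d1) (ltn_ord d2).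
move=> ? ? ? ? E2 E1 E0; congr (_, _); apply: val_inj => /=;
  by move: E2 E1 E0; case: ifP => _; lia.
Qed.

Lemma cell_classP x c : reflect
  ((c.1 + c.2 < q)%N = one_cyc_descent x /\
   (c.1 + c.2 + c.2 =
     (if one_cyc_descent x then cyc_descent x 1 + cyc_descent x 1 + cyc_descent x 2
      else cyc_descent x 1 + cyc_descent x 2 + cyc_descent x 2) %[mod 3])%N)
  (cell_class c == perm_class x).
Proof.
apply: (iffP eqP) => [[-> E]|[E1 E2]]; last by rewrite /cell_class E1 E2.
by split=> //; move/(congr1 val): E; rewrite /= !inordK ?ltn_mod.
Qed.

Lemma cyc_descent_le1 x i : (cyc_descent x i <= 1)%N.
Proof. exact: leq_b1. Qed.

Lemma cyc_descent_sum x :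
  (1 <= cyc_descent x 0 + cyc_descent x 1 + cyc_descent x 2 <= 2)%N.
Proof.
rewrite /cyc_descent /=.
by case: (S3_cases x) => [|||[]] [[-> -> ->] _].
Qed.

Lemma cellini_vectors_cells x :
  cellini_vectors q x =
  cell_vector x @` [set c | c \in [pred c | cell_class c == perm_class x]].
Proof.
have [f0 f1 f2] :=
  And3 (cyc_descent_le1 x 0) (cyc_descent_le1 x 1) (cyc_descent_le1 x 2).
have fs := cyc_descent_sum x.
apply/seteqP; split=> [u /cellini3P[su]|_ [c /cell_classP [c12 cmod] <-]].
  rewrite -/(cyc_descent x 0) -/(cyc_descent x 1) -/(cyc_descent x 2) => C1 C2 C0.
  rewrite sum3E in su.
  pose n1 := absz (u 0 o0 - u 0 o1 - (cyc_descent x 1)%:Z)%R.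
  pose n2 := absz (u 0 o1 - u 0 o2 - (cyc_descent x 2)%:Z)%R.
  have m1 : ((if one_cyc_descent x then n1 else q.-1 - n1) < q)%N.
    by rewrite /n1 /one_cyc_descent; case: eqP; lia.
  have m2 : ((if one_cyc_descent x then n2 else q.-1 - n2) < q)%N.
    by rewrite /n2 /one_cyc_descent; case: eqP; lia.
  exists (Ordinal m1, Ordinal m2).
    apply/cell_classP; rewrite /= /one_cyc_descent /n1 /n2; case: eqP; lia.
  apply/rowP => j; rewrite !mxE /=.
  have reflectK n : (n < q)%N -> (if one_cyc_descent x then
      if one_cyc_descent x then n else q.-1 - n
      else q.-1 - (if one_cyc_descent x then n else q.-1 - n))%N = n.
    by case: (one_cyc_descent x) => ?; lia.
  have [n1q n2q] : (n1 < q)%N /\ (n2 < q)%N by rewrite /n1 /n2; lia.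
  rewrite !reflectK // /n1 /n2.
  by case: (ord3P j) => -> /=; lia.
apply/cellini3P.
rewrite -/(cyc_descent x 0) -/(cyc_descent x 1) -/(cyc_descent x 2).
have [l1 l2] := (ltn_ord c.1, ltn_ord c.2).
rewrite sum3E !mxE /=; move: c12 cmod; rewrite /one_cyc_descent; case: eqP => D.
  by split; lia.
by split; lia.
Qed.

End Cells.

(** Every element of the symmetric group on three letters is an involution or a
    [3]-cycle. A [3]-cycle has one cyclic descent, at [1] or [2], and its inverse
    has it at the other of these two places. *)
Lemma card_cells_inv q (x : 'S_3) :
  #|[pred c : 'I_q * 'I_q | cell_class c == perm_class x^-1%g]| =
  #|[pred c : 'I_q * 'I_q | cell_class c == perm_class x]|.
Proof.
pose sw (c : 'I_q * 'I_q) := (c.2, c.1).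
suff [->//|E] : x^-1%g = x \/
    forall c,
      (cell_class c == perm_class x^-1%g) = (cell_class (sw c) == perm_class x).
  have swK : involutive sw by case.
  rewrite -!sum1_card [RHS](reindex_inj (inv_inj swK)).
  by apply: eq_bigl => c; rewrite !inE E.
case: (S3_cases x) => [|||[]] [[x0 x1 x2] [y0 y1 y2]].
5,6: right=> c; apply/cell_classP/cell_classP;
  rewrite /one_cyc_descent /cyc_descent /= ?x0 ?x1 ?x2 ?y0 ?y1 ?y2 /=; lia.
all: by left; apply/permP => i; case: (ord3P i) => ->; rewrite ?x0 ?x1 ?x2.
Qed.

(** * Counting stable points *)

(** If [q v = w v], then [q ^ k v = v] for the order [k] of [w], so [v = 0]. *)
Lemma subr_perm_unitmx (R : realFieldType) (m q : nat) (w : 'S_m.+1) :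
  (1 < q)%N ->
  (q%:R%:M - perm_mx w : 'M[R]_m.+1) \in unitmx.
Proof.
move=> q1; rewrite -row_free_unit; apply: inj_row_free => v.
rewrite mulmxBr mul_mx_scalar => /eqP; rewrite subr_eq0 => /eqP vE.
have vX k : (q ^ k)%:R *: v = v *m perm_mx (w ^+ k)%g.
  elim: k => [|k IHk]; first by rewrite expg0 perm_mx1 mulmx1 scale1r.
  rewrite expnS mulnC natrM -scalerA vE scalemxAl IHk -mulmxA -perm_mxM.
  by rewrite -expgSr.
have /eqP := vX #[w]%g; rewrite expg_order perm_mx1 mulmx1.
rewrite -subr_eq0 -[X in _ - X]scale1r -scalerBl scaler_eq0 => /orP[|/eqP//].
have /negPf qw1 : (q ^ #[w]%g)%N != 1%N.
  by rewrite -(expn0 q) eqn_exp2l // -lt0n order_gt0.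
by rewrite subr_eq0 pnatr_eq1 qw1.
Qed.

Section Count.
Variables (R : realType) (p e : nat).
Hypotheses (p_pr : prime p) (e_gt0 : (0 < e)%N).
Let q := (p ^ e)%N.

Let q_gt1 : (1 < q)%N.
Proof. by rewrite -(expn0 p) ltn_exp2l // prime_gt1. Qed.

(** The point whose translation vector for [w] is [u]. *)
Definition point_of_translation (w : 'S_3) (u : 'rV[int]_3) : 'rV[R]_3 :=
  map_mx intr u *m invmx (q%:R%:M - perm_mx w).

Lemma point_of_translationP w u v :
  v = point_of_translation w u <-> q%:R *: v = perm_act w v + map_mx intr u.
Proof.
have qw : (q%:R%:M - perm_mx w : 'M[R]_3) \in unitmx.
  exact: subr_perm_unitmx.
have E : v *m (q%:R%:M - perm_mx w) = map_mx intr u <->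
    q%:R *: v = perm_act w v + map_mx intr u.
  rewrite mulmxBr mul_mx_scalar -perm_act_mulmx.
  by split=> [<-|->]; rewrite addrC ?subrK ?addKr.
rewrite /point_of_translation; apply: iff_trans E.
by split=> [->|<-]; rewrite ?mulmxKV ?mulmxK.
Qed.

Lemma point_of_translation_inj w : injective (point_of_translation w).
Proof.
move=> u1 u2 E; have /point_of_translationP := erefl (point_of_translation w u1).
rewrite {1 2}E.
have /point_of_translationP -> := erefl (point_of_translation w u2).
move/addrI/rowP => uE; apply/rowP => i.
by have := uE i; rewrite !mxE => /intr_inj.
Qed.

Definition shortest_set w :=
  [set v : 'rV[R]_3 | F_stable p q v /\ is_shortest q v w].

Lemma shortest_setE w :
  shortest_set w = point_of_translation w @` cellini_vectors q w^-1%g.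
Proof.
apply/seteqP; split=> [v [/F_stableP-/(_ p_pr e_gt0)[Av _] vw]|_ [u Cu <-]].
  have [[y [Zy sy] vE] _] := vw.
  have /fin_all_exists [f fE] : forall i, exists n : int, y 0 i = n%:~R.
    by move=> i; apply/intrP.
  have yE : y = map_mx intr (\row_i f i) by apply/rowP => i; rewrite !mxE fE.
  rewrite yE in vE; exists (\row_i f i); last by apply/esym/point_of_translationP.
  by apply: (shortest_cellini q_gt1 _ vE) => //; case: Av.
have vE := (point_of_translationP w u _).1 erefl.
set v := point_of_translation w u in vE *.
have sv : \sum_i v 0 i = 0.
  have [su _ _ _] := Cu.
  have := congr1 (fun z : 'rV[R]_3 => \sum_i z 0 i) vE.
  rewrite sum_rowZ sum_rowD sum_perm_act.
  have -> : \sum_i map_mx intr u 0 i = 0 :> R.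
    rewrite (eq_bigr (fun i => (u 0 i)%:~R)) => [|i _]; last by rewrite mxE.
    by rewrite -rmorph_sum /= su.
  rewrite addr0 => /eqP; rewrite -subr_eq0 -[X in _ - X]mul1r -mulrBl mulf_eq0.
  by rewrite subr_eq0 pnatr_eq1 gtn_eqF // => /eqP.
have [Av vw] := cellini_shortest q_gt1 sv vE Cu.
by split=> //; apply/F_stableP => //; split=> //; exists w; case: vw.
Qed.

Lemma card_cellini_vectors x : #|` fset_set (cellini_vectors q x)| =
  #|[pred c : 'I_q * 'I_q | cell_class c == perm_class x]|.
Proof.
rewrite cellini_vectors_cells card_fset_set_image // => c d _ _.
exact: cell_vector_inj.
Qed.

Lemma card_shortest_set w : #|` fset_set (shortest_set w)| =
  #|[pred c : 'I_q * 'I_q | cell_class c == perm_class w^-1%g]|.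
Proof.
rewrite shortest_setE cellini_vectors_cells image_comp card_fset_set_image //.
by move=> c d _ _ /point_of_translation_inj/cell_vector_inj.
Qed.

(** Each cell of the square determines the permutation of its class, hence a
    stable point; every stable point arises once, from its shortest element. *)
Lemma card_F_stable : #|` fset_set (@F_stable R 2 p q)| = (q ^ 2)%N.
Proof.
have [g gK Kg] := perm_class_bij.
pose w (c : 'I_q * 'I_q) := (g (cell_class c))^-1%g.
pose psi c := point_of_translation (w c) (cell_vector (w c)^-1 c).
have psi_short c : shortest_set (w c) (psi c).
  rewrite shortest_setE cellini_vectors_cells.
  exists (cell_vector (w c)^-1 c) => //.
  by exists c; rewrite //= inE /w invgK Kg.
have -> : @F_stable R 2 p q = psi @` [set c | c \in predT].
  apply/seteqP; split=> [v Fv|_ [c _ <-]]; last by case: (psi_short c).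
  have [Av [x qvx]] := (F_stableP v p_pr e_gt0).1 Fv.
  have [y vy] := exists_shortest (let: And3 sv _ _ := Av in sv) qvx.
  have : shortest_set y v by [].
  rewrite shortest_setE cellini_vectors_cells => -[_ [c /eqP ctype <-] <-].
  exists c => //; rewrite /psi /w ctype gK invgK //.
rewrite card_fset_set_image => [|c d _ _ E].
  by rewrite cardT /= -cardE card_prod card_ord.
have [_ sc] := psi_short c; have [_ sd] := psi_short d; rewrite -E in sd.
have wE := shortest_unique sc sd; move: E; rewrite /psi wE.
by move=> /point_of_translation_inj/cell_vector_inj.
Qed.

End Count.

Theorem theorem8 (R : realType) (p e q : nat) (hp : prime p) (he : (0 < e)%N)
  (hq : q = (p ^ e)%N) (sigma : 'S_3) :
  shortest_prob R p q sigma = cellini 2 q sigma.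
Proof.
rewrite hq /shortest_prob ffunE card_F_stable // card_cellini_vectors //.
by rewrite -card_cells_inv -(card_shortest_set R).
Qed.
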